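(* Let $R$ be a finite ring. Any (nonempty) finite sequence in $R$ is a quiddity sequence for some tame semiregular frieze over $R$ (of some width $n\geq 2$).
   Context: All rings are commutative with identity $1$. A frieze of width $n\geq 2$ over $R$ is a function $\mathbf{F}\colon\{(i,j)\in\mathbb{Z}^2:0\leq i-j\leq n\}\to R$, $m_{i,j}=\mathbf{F}(i,j)$, with $m_{i,i}=m_{n+i,i}=0$ for all $i\in\mathbb{Z}$ and $m_{i,j}m_{i+1,j+1}-m_{i,j+1}m_{i+1,j}=1$ for $0<i-j<n$. It is tame if the 3-by-3 matrix with rows $i-1,i,i+1$ and columns $j-1,j,j+1$ of entries of $\mathbf{F}$ has determinant $0$ whenever $1<i-j<n-1$. It is semiregular if $m_{i+1,i}=1$ for all $i\in\mathbb{Z}$. A quiddity sequence for a tame semiregular frieze $\mathbf{F}$ over a finite ring is a period $a_1,a_2,\dots,a_k$ (not necessarily of minimal length) of the third row $(m_{i+1,i-1})_{i\in\mathbb{Z}}$ of $\mathbf{F}$; that is, the third row is periodic with period $k$, and $a_1,\dots,a_k$ are $k$ consecutive entries of it. *)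

(* Defs.v *)
From mathcomp Require Import all_boot all_order all_algebra.

Set Implicit Arguments.
Unset Strict Implicit.
Unset Printing Implicit Defensive.

Import Order.TTheory GRing.Theory Num.Theory.
Local Open Scope ring_scope.

(* A frieze of width n is a function on the strip 0 <= i - j <= n. It is
   represented by a total function on int * int whose values outside the strip
   are irrelevant: no definition below reads an entry outside the strip. *)
Section Friezes.

Variable R : comPzRingType.
Implicit Types (n : nat) (m : int -> int -> R).

Definition is_frieze n m : Prop :=
  [/\ (2 <= n)%N,
      forall i : int, m i i = 0,
      forall i : int, m (n%:Z + i) i = 0
    & forall i j : int, 0 < i - j < n%:Z ->
        m i j * m (i + 1) (j + 1) - m i (j + 1) * m (i + 1) j = 1].

Definition block3 m (i j : int) : 'M[R]_3 :=
  \matrix_(u < 3, v < 3) m (i - 1 + (u : nat)%:Z) (j - 1 + (v : nat)%:Z).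

Definition tame n m : Prop :=
  forall i j : int, 1 < i - j < n%:Z - 1 -> \det (block3 m i j) = 0.

Definition semiregular m : Prop := forall i : int, m (i + 1) i = 1.

Definition third_row m (i : int) : R := m (i + 1) (i - 1).

(* The period size s need not be minimal, and s may start anywhere in the
   third row. *)
Definition quiddity_sequence m (s : seq R) : Prop :=
  [/\ (0 < size s)%N,
      forall i : int, third_row m (i + (size s)%:Z) = third_row m i
    & exists i0 : int, forall t : nat, (t < size s)%N ->
        third_row m (i0 + t%:Z) = s`_t].

End Friezes.

(* Main.v *)
Require Import Defs.
From mathcomp Require Import all_boot all_order all_algebra.
From mathcomp Require Import ring zify.

Import Order.TTheory GRing.Theory Num.Theory.

(** Let [p] and [q] be two solutions, indexed by the integers, of the discrete
    Hill equation [x (i + 1) = a i * x i - x (i - 1)] whose Wronskian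
    [p (i + 1) * q i - q (i + 1) * p i] is 1. The 2-by-2 minors
    [m i j = p i * q j - q i * p j] of the two-row array [(p, q)] then form a
    frieze pattern: the diamond rule is the Pluecker relation, tameness says
    that [m] has rank at most 2, the row next to the zeros is the Wronskian, and
    the third row is [a]. The remaining boundary condition [m (n + i) i = 0]
    follows as soon as [p] and [q] have period [n].

    Over a finite ring such a period comes for free. When [a] is the periodic
    extension of [s], the position in [s] together with the two most recent
    values of [p] and of [q] determines the next such tuple, and also the
    previous one, because the equation can be solved for [x (i - 1)]. So the
    sequence of tuples is an orbit of an injective self-map of a finite set,
    hence purely periodic, and it extends to all integers. The map is
    [hill_step], and the orbit over the integers is [periodic_int_orbit]. *)

(** * Orbits indexed by the integers *)

(** An orbit of an injective self-map of a finite set is a cycle, so it can be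
    continued to negative indices by reducing the index modulo a multiple of
    the cycle length; twice that length secures [2 <= n]. The third clause
    carries invariants of [f] over to all integer indices. *)
Lemma periodic_int_orbit {T : finType} {f : T -> T} (x0 : T) :
    injective f ->
  exists (n : nat) (u : int -> T),
    [/\ (2 <= n)%N, forall i : int, u (n%:Z + i)%R = u i,
        forall i : int, exists k : nat, u i = iter k f x0,
        u 0%R = x0 & forall i : int, u (i + 1)%R = f (u i)].
Proof.
move=> f_inj; set n := ((order f x0).*2)%N.
have n_ge2 : (2 <= n)%N by rewrite /n -addnn; have := order_gt0 f x0; lia.
have iter_n : iter n f x0 = x0 by rewrite /n -addnn iterD !iter_order.
exists n, (fun i => iter `|(i %% n%:Z)%Z|%N f x0); split => //.
- by move=> i; rewrite modzDl.
- by move=> i; exists `|(i %% n%:Z)%Z|%N.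
- by rewrite mod0z.
move=> i; rewrite -modzDml.
have r_ge0 : (0 <= (i %% n%:Z)%Z)%R by apply: modz_ge0; lia.
have r_lt : ((i %% n%:Z)%Z < n%:Z)%R by apply: ltz_pmod; lia.
case: (i %% n%:Z)%Z r_ge0 r_lt => // r _ r_lt; rewrite -PoszD modz_nat !absz_nat.
have [in_r1 | r1_lt] : (r + 1)%N = n \/ (r + 1 < n)%N by lia.
  (* The index wraps around, and [r + 1 = n] brings the orbit back to [x0]. *)
  by rewrite in_r1 modnn -iterS -addn1 in_r1 iter_n.
by rewrite modn_small // addn1 iterS.
Qed.

Local Open Scope ring_scope.

(** * The rank-two array of a pair of sequences *)

(** Pluecker coordinate on columns [i] and [j] of the array with rows [p], [q]. *)
Definition wedge {R : comPzRingType} (p q : int -> R) (i j : int) : R :=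
  p i * q j - q i * p j.

(** Every 3-by-3 block is the product of a 3-by-2 and a 2-by-3 matrix built
    from [p] and [q], so its determinant vanishes identically. *)
Lemma tame_wedge {R : comPzRingType} (n : nat) (p q : int -> R) :
  tame n (wedge p q).
Proof.
move=> i j _.
rewrite (expand_det_row _ ord0) !big_ord_recl big_ord0 /cofactor.
rewrite !(expand_det_row _ ord0) !big_ord_recl !big_ord0 /cofactor.
rewrite !det_mx11 !mxE /= /wedge.
ring.
Qed.

(** With Wronskian 1, the diamond rule is the Pluecker relation
    [m i j * m k l - m i l * m k j = m k i * m l j], for [k = i + 1] and
    [l = j + 1], whose right-hand side is a product of two Wronskians. *)
Lemma frieze_wedge {R : comPzRingType} {n : nat} {p q : int -> R} :
    (2 <= n)%N ->
    (forall i : int, p (n%:Z + i) = p i) ->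
    (forall i : int, q (n%:Z + i) = q i) ->
    (forall i : int, wedge p q (i + 1) i = 1) ->
  is_frieze n (wedge p q).
Proof.
move=> n_ge2 p_per q_per W1; split=> // [i | i | i j _].
- by rewrite /wedge mulrC subrr.
- by rewrite /wedge p_per q_per mulrC subrr.
rewrite -[RHS]mulr1 -{1}(W1 i) -(W1 j) /wedge; ring.
Qed.

(** Eliminating [p (i + 1)] and [q (i + 1)] leaves [a i] times the Wronskian at
    [i - 1], since the terms in [p (i - 1) * q (i - 1)] cancel. *)
Lemma third_row_wedge {R : comPzRingType} {p q a : int -> R} :
    (forall i : int, wedge p q (i + 1) i = 1) ->
    (forall i : int, p (i + 1) = a i * p i - p (i - 1)) ->
    (forall i : int, q (i + 1) = a i * q i - q (i - 1)) ->
  forall i : int, third_row (wedge p q) i = a i.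
Proof.
move=> W1 p_rec q_rec i; rewrite /third_row.
rewrite -[RHS]mulr1 -(W1 (i - 1)) subrK /wedge p_rec q_rec; ring.
Qed.

(** * The equation of the sequence as a dynamical system *)

(** In a state [(t, x, y)], [t] is a position in [s], read cyclically, and the
    pairs [x] and [y] hold the current and the previous value of two solutions. *)
Definition hill_step {R : finComPzRingType} (s : seq R)
    (z : 'I_(size s) * (R * R) * (R * R)) : 'I_(size s) * (R * R) * (R * R) :=
  let: (t, x, y) := z in
  (ordS t, (s`_t * x.1 - x.2, x.1), (s`_t * y.1 - y.2, y.1)).

Lemma hill_step_inj {R : finComPzRingType} (s : seq R) :
  injective (hill_step s).
Proof.
move=> [[t [x x']] [y y']] [[t2 [x2 x2']] [y2 y2']] /=.
case=> eq_next + eq_x + eq_y.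
have /ordS_inj -> : ordS t = ordS t2 by apply: val_inj.
by rewrite eq_x eq_y => /addrI /oppr_inj -> /addrI /oppr_inj ->.
Qed.

Definition wronskian {R : comPzRingType} {T : Type}
    (z : T * (R * R) * (R * R)) : R :=
  z.1.2.1 * z.2.2 - z.2.1 * z.1.2.2.

(** The step acts on both pairs by the same matrix of determinant 1. *)
Lemma wronskian_hill_step {R : finComPzRingType} (s : seq R) z :
  wronskian (hill_step s z) = wronskian z.
Proof. by case: z => [[t x] y]; rewrite /wronskian /=; ring. Qed.

Theorem theorem1p4 (R : finComPzRingType) (s : seq R) (hs : (0 < size s)%N) :
  exists (n : nat) (m : int -> int -> R),
    [/\ is_frieze n m, tame n m, semiregular m & quiddity_sequence m s].
Proof.
(* The initial pairs [(1, 0)] and [(0, 1)] give Wronskian 1. *)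
have [n [u [n_ge2 u_per u_orb u0 u_step]]] :=
  periodic_int_orbit (Ordinal hs, (1, 0), (0, 1)) (@hill_step_inj R s).
pose t i := (u i).1.1; pose p i := (u i).1.2.1; pose q i := (u i).2.1.
have t_step i : t (i + 1) = ordS (t i).
  by rewrite /t u_step; case: (u i) => [[]].
have p_prev i : (u (i + 1)).1.2.2 = p i.
  by rewrite u_step /p; case: (u i) => [[]].
have q_prev i : (u (i + 1)).2.2 = q i.
  by rewrite u_step /q; case: (u i) => [[]].
have p_rec i : p (i + 1) = s`_(t i) * p i - p (i - 1).
  by rewrite -(p_prev (i - 1)) subrK /p u_step /t; case: (u i) => [[]].
have q_rec i : q (i + 1) = s`_(t i) * q i - q (i - 1).
  by rewrite -(q_prev (i - 1)) subrK /q u_step /t; case: (u i) => [[]].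
have W1 i : wedge p q (i + 1) i = 1.
  rewrite /wedge -(p_prev i) -(q_prev i) -/(wronskian (u (i + 1))).
  have [k ->] := u_orb (i + 1); elim: k => [|k IHk].
    by rewrite /wronskian /= mulr1 mul0r subr0.
  by rewrite iterS wronskian_hill_step.
have t_add i (k : nat) : t (i + k%:Z) = ((t i + k) %% size s)%N :> nat.
  elim: k => [|k IHk]; first by rewrite addr0 addn0 modn_small.
  by rewrite -addn1 PoszD addrA t_step /= IHk -addn1 modnDml addn1 addnA addn1.
exists n, (wedge p q); split=> //.
- by apply: frieze_wedge => // i; rewrite /p /q u_per.
- exact: tame_wedge.
have row3 := third_row_wedge W1 p_rec q_rec.
split=> // [i|]; first by rewrite !row3 t_add modnDr modn_small.
exists 0 => k k_lt.
by rewrite row3 t_add /t u0 /= add0n modn_small.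
Qed.
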